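(* For all $n\ge1$ and $j\ge0$, $$\bar{\mathbb{B}}_n^{-1}e_j=\frac1{n^j}\sum_{k=0}^j(-1)^{j-k}\frac{(n-1+k)!}{(n-1)!}\,S(j,k)\,e_k .$$ Consequently $\lim_{n\to\infty}\bar{\mathbb{B}}_n^{-1}e_j=e_j$ for every $j\ge0$.
   Context: $e_j(x)=x^j$. $S(j,k)$ are the Stirling numbers of the second kind: $y^j=\sum_{k=0}^jS(j,k)\,y(y-1)\cdots(y-k+1)$. The genuine Beta operator $\bar{\mathbb{B}}_n:C[0,1]\to C[0,1]$ is defined by $\bar{\mathbb{B}}_n(f;0)=f(0)$, $\bar{\mathbb{B}}_n(f;1)=f(1)$, and for $x\in(0,1)$ $$\bar{\mathbb{B}}_n(f;x)=\frac{1}{B(nx,n(1-x))}\int_0^1 t^{nx-1}(1-t)^{n(1-x)-1}f(t)\,dt,$$ where $B(\cdot,\cdot)$ is the Euler Beta function. It maps the space of polynomials of degree at most $m$ bijectively onto itself for every $m$, and $\bar{\mathbb{B}}_n^{-1}$ denotes its inverse on polynomials. Convergence is uniform on $[0,1]$ (equivalently, coefficientwise). *)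

(* Defs.v *)
From HB Require Import structures.
From mathcomp Require Import all_boot all_order all_algebra.
From mathcomp Require Import all_classical all_reals all_analysis.

Set Implicit Arguments.
Unset Strict Implicit.
Unset Printing Implicit Defensive.

Import Order.TTheory GRing.Theory Num.Theory.
Import numFieldNormedType.Exports.

Local Open Scope classical_set_scope.
Local Open Scope ring_scope.

Definition falling_poly (k : nat) : {poly int} :=
  \prod_(i < k) ('X - (i%:R)%:P).

(* The second clause is the usual convention outside the triangle k <= j,
   where the expansion of y^j does not constrain the coefficients. *)
Definition is_stirling2_row (j : nat) (S : nat -> int) : Prop :=
  'X^j = \sum_(k < j.+1) S k *: falling_poly k
  /\ forall k, (j < k)%N -> S k = 0.

Lemma falling_polyS k :
  falling_poly k.+1 = falling_poly k * ('X - (k%:R)%:P).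
Proof. by rewrite /falling_poly big_ord_recr. Qed.

Lemma stirling2_row_ex j : exists S, is_stirling2_row j S.
Proof.
elim: j => [|j [S [Sj S0]]].
  exists (fun k => if k is 0%N then 1 else 0); split; last by case.
  by rewrite big_ord1 /= /falling_poly big_ord0 expr0 scale1r.
exists (fun k => (if k is k'.+1 then S k' else 0) + k%:R * S k); split; last first.
  by case=> // k jk; rewrite !S0 ?mulr0 ?addr0// ltnW.
have E (k : nat) : 'X * falling_poly k = falling_poly k.+1 + k%:R *: falling_poly k.
  by rewrite falling_polyS mulrBr -mul_polyC [falling_poly k * _%:P]mulrC
             [_ * 'X]mulrC subrK.
rewrite exprS Sj mulr_sumr.
under eq_bigr => k _ do rewrite -scalerAr E scalerDr scalerA.
under [RHS]eq_bigr => k _ do rewrite scalerDl.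
rewrite !big_split /=; congr (_ + _).
  by rewrite [RHS]big_ord_recl /= scale0r add0r.
rewrite [RHS]big_ord_recr /= S0// mulr0 scale0r addr0.
by apply: eq_bigr => k _; rewrite mulrC.
Qed.

Lemma falling_poly_eval (k m : nat) :
  (falling_poly k).[m%:R] = \prod_(i < k) (m%:R - i%:R).
Proof.
by rewrite horner_prod; apply: eq_bigr => i _; rewrite hornerXsubC.
Qed.

Lemma stirling2_row_uniq j S S' :
  is_stirling2_row j S -> is_stirling2_row j S' -> S =1 S'.
Proof.
move=> [Sj S0] [S'j S'0] k.
have [jk|kj] := ltnP j k; first by rewrite S0 ?S'0.
elim/ltn_ind: k kj => k IH kj.
have : \sum_(i < j.+1) (S i - S' i) *: falling_poly i = 0.
  under eq_bigr => i _ do rewrite scalerBl.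
  by rewrite sumrB -Sj -S'j subrr.
move/(congr1 (horner^~ k%:R)); rewrite horner_sum horner0.
rewrite (bigD1 (Ordinal (kj : (k < j.+1)%N)))//= big1 => [|i ik].
  rewrite addr0 hornerZ falling_poly_eval => /eqP.
  rewrite mulf_eq0 subr_eq0 => /orP[/eqP//|/prodf_eq0[i _]].
  by rewrite subr_eq0 eqr_nat gtn_eqF.
have [ltik|leki] := ltnP i k.
  by rewrite IH// ?subrr ?scale0r ?horner0// ltnW// (leq_trans ltik).
have ki : (k < i)%N.
  by rewrite ltn_neqAle leki andbT; apply: contraNneq ik => e; apply/eqP/val_inj.
by rewrite hornerZ falling_poly_eval (bigD1 (Ordinal ki))//= subrr mul0r mulr0.
Qed.

Definition stirling2 (j : nat) : nat -> int := sval (cid (stirling2_row_ex j)).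

Lemma stirling2P j : is_stirling2_row j (stirling2 j).
Proof. exact: svalP. Qed.

Section genuine_beta.
Variable R : realType.
Local Notation mu := (@lebesgue_measure R).

(* The library's [beta_fun] only takes natural number parameters. *)
Definition euler_beta (a b : R) : R :=
  \int[mu]_(t in `]0, 1[) (t `^ (a - 1) * (1 - t) `^ (b - 1)).

(* Only meaningful for 0 < n, f continuous on [0, 1] and x in [0, 1]. *)
Definition genuine_beta (n : nat) (f : R -> R) (x : R) : R :=
  if x == 0 then f 0
  else if x == 1 then f 1
  else (euler_beta (n%:R * x) (n%:R * (1 - x)))^-1 *
    \int[mu]_(t in `]0, 1[)
      (t `^ (n%:R * x - 1) * (1 - t) `^ (n%:R * (1 - x) - 1) * f t).

(* Inverse of [genuine_beta n] on polynomials: the polynomial p whose image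
   agrees with q on [0, 1]. For 0 < n it exists and is unique, because
   [genuine_beta n] permutes the polynomials of degree at most m for every m;
   the default value 0 is then never used. *)
Definition genuine_beta_inv (n : nat) (q : {poly R}) : {poly R} :=
  xget 0 [set p : {poly R} |
    forall x, x \in `[0, 1] -> genuine_beta n (horner p) x = q.[x]].

End genuine_beta.

(* Main.v *)
(* Integrating the derivative of t^a (1 - t)^b gives
   (a + b) B(a + 1, b) = a B(a, b), so the k-th moment of the Beta distribution
   with parameters n x and n (1 - x) is (n x)_k / (n)_k, with rising factorials.
   The operator thus sends e_k to (n x)_k / (n)_k, and it is inverted by the
   Stirling expansion of y^j at y = - n x, where falling factorials become
   rising ones up to sign. At y = n the same expansion shows that the
   coefficients of the inverse image of e_j sum to 1, while those of index
   k < j are O(1/n): the one of index j tends to 1. *)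

Require Import Defs.
From HB Require Import structures.
From mathcomp Require Import all_boot all_order all_algebra.
From mathcomp Require Import all_classical all_reals all_analysis.
From mathcomp Require Import measurable_realfun ring lra.

Set Implicit Arguments.
Unset Strict Implicit.
Unset Printing Implicit Defensive.

Import Order.TTheory GRing.Theory Num.Theory.
Import numFieldNormedType.Exports.

Local Open Scope classical_set_scope.
Local Open Scope ring_scope.

(** * Euler's Beta integral: kernel, integrability, recurrence, positivity *)

Section euler_beta_theory.
Context {R : realType}.
Local Notation mu := (@lebesgue_measure R).
Implicit Types (a b t : R) (n : nat).

Definition beta_kernel a b t : R := t `^ (a - 1) * (1 - t) `^ (b - 1).

Lemma beta_kernel_ge0 a b t : 0 <= beta_kernel a b t.
Proof. by rewrite mulr_ge0 ?powR_ge0. Qed.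

Lemma beta_kernelXl a b t (k : nat) : 0 < t ->
  beta_kernel (a + k%:R) b t = beta_kernel a b t * t ^+ k.
Proof.
move=> t0; rewrite /beta_kernel (addrAC a) (@powRD _ t (a - 1) k%:R); last first.
  by rewrite (gt_eqF t0) implybT.
by rewrite powR_mulrn ?ltW// mulrAC.
Qed.

Lemma beta_kernelDl a b t : 0 < t < 1 ->
  beta_kernel (a + 1) b t = beta_kernel a b t * t.
Proof. by move=> /andP[t0 _]; have := @beta_kernelXl a b t 1 t0; rewrite expr1. Qed.

Lemma beta_kernelDr a b t : 0 < t < 1 ->
  beta_kernel a (b + 1) t = beta_kernel a b t * (1 - t).
Proof.
move=> /andP[_ t1]; have t1' : 0 < 1 - t by rewrite subr_gt0.
have := @beta_kernelXl b a _ 1 t1'.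
by rewrite /beta_kernel subKr expr1 mulrC => ->; rewrite mulrAC mulrC mulrA.
Qed.

Let F a b t : R := t `^ a * (1 - t) `^ b.

Let FE a b : F a b = beta_kernel (a + 1) (b + 1).
Proof. by apply/funext => t; rewrite /F /beta_kernel !addrK. Qed.

(** The product rule gives [a * beta_kernel a (b + 1) t - b * beta_kernel (a + 1) b t]; expanding
    the factor [1 - t] in the first kernel leaves only kernels with second parameter [b]. *)
Lemma is_derive_beta_kernel a b t : 0 < t < 1 ->
  is_derive t 1 (beta_kernel (a + 1) (b + 1))
    (a * beta_kernel a b t - (a + b) * beta_kernel (a + 1) b t).
Proof.
move=> t01; have /andP[t0 t1] := t01.
have t1' : 0 < 1 - t by rewrite subr_gt0.
have d1 := is_derive1_powR a t0.
have d2 : is_derive t 1 ((fun x : R => x `^ b) \o (fun x : R => 1 - x))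
   ((b * (1 - t) `^ (b - 1)) * (-1)).
  apply: is_derive1_comp; first exact: is_derive1_powR.
  rewrite -[X in is_derive _ _ _ X]add0r; exact: is_deriveB.
rewrite -FE; apply: (is_derive_eq (is_deriveM d1 d2)).
have -> : a * beta_kernel a b t - (a + b) * beta_kernel (a + 1) b t =
  a * beta_kernel a (b + 1) t - b * beta_kernel (a + 1) b t.
  by rewrite beta_kernelDl// beta_kernelDr//; ring.
rewrite /beta_kernel !addrK /GRing.scale /=; ring.
Qed.

(** The derivative formula holds for all real parameters, so it applies at [(a - 1, b - 1)], whose
    shift is [(a, b)]. *)
Lemma beta_kernel_continuous a b t : 0 < t < 1 ->
  {for t, continuous (beta_kernel a b)}.
Proof.
move=> t01; apply/differentiable_continuous; rewrite -derivable1_diffP.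
by have [] := is_derive_beta_kernel (a - 1) (b - 1) t01; rewrite !subrK.
Qed.

(** * Exhaustion of []0, 1[] by compact intervals *)

Let eps n : R := n.+3%:R^-1.

Let eps_gt0 n : 0 < eps n. Proof. by rewrite invr_gt0. Qed.

(** The offset 3 in [eps] makes this true already at [n = 0]: no [K n] degenerates, and [K 0] is the
    middle third. *)
Let eps_half n : eps n < 1 - eps n.
Proof.
rewrite ltrBrDr -mulr2n -mulr_natr mulrC ltr_pdivrMr// mul1r ltr_nat//.
Qed.

Let eps_cvg0 : eps n @[n --> \oo] --> (0 : R).
Proof.
rewrite (_ : eps = [sequence @harmonic R (n + 2)%N]_n).
  by rewrite cvg_shiftn; exact: cvg_harmonic.
by apply/funext => n; rewrite /eps /= addn2.
Qed.

Let K n : set R := `[eps n, 1 - eps n]%classic.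

Let K01 n t : K n t -> 0 < t < 1.
Proof.
rewrite /K/= in_itv/= => /andP[et te].
rewrite (lt_le_trans (eps_gt0 n) et) (le_lt_trans te)// ltrBlDr ltrDl//.
Qed.

Let mK n : measurable (K n). Proof. exact: measurable_itv. Qed.

Let nondecreasing_K : nondecreasing_seq K.
Proof.
move=> m n mn; apply/subsetPset => t; rewrite /K/= !in_itv/= => /andP[et te].
have e : eps n <= eps m by rewrite lef_pV2 ?posrE// ler_nat !ltnS.
by rewrite (le_trans e et) (le_trans te)// lerD2l lerN2.
Qed.

Let bigcup_K : \bigcup_n K n = `]0, 1[%classic.
Proof.
apply/seteqP; split=> [t [n _] /K01|t]; first by rewrite /= in_itv.
rewrite /= in_itv/= => /andP[t0 t1].
have m0 : 0 < Num.min t (1 - t) by rewrite lt_min t0 subr_gt0.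
have [n _ /(_ n (leqnn n))] := (cvgr0Pnorm_lt _).1 eps_cvg0 _ m0.
rewrite /= gtr0_norm ?eps_gt0// lt_min => /andP[nt nt1].
by exists n => //; rewrite /K/= in_itv/= (ltW nt)/= lerBrDr addrC -lerBrDr ltW.
Qed.

(* The only analytic input is the recurrence [J_shift] on compact subintervals:
   since its right-hand side tends to 0, it carries integrability on ]0, 1[ from
   [(a + 1, b + 1)], where the kernel is bounded, down to [(a, b)]. *)
Let J a b n : R := \int[mu]_(t in K n) beta_kernel a b t.

Let within_K a b n : {within K n, continuous (beta_kernel a b)}.
Proof.
apply: continuous_in_subspaceT => t; rewrite inE => /K01.
exact: beta_kernel_continuous.
Qed.

Let integrable_K a b n : mu.-integrable (K n) (EFin \o beta_kernel a b).
Proof.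
apply: continuous_compact_integrable; last exact: within_K.
exact: segment_compact.
Qed.

Let J_shift a b n : a * J a b n - (a + b) * J (a + 1) b n =
  beta_kernel (a + 1) (b + 1) (1 - eps n) - beta_kernel (a + 1) (b + 1) (eps n).
Proof.
have c t : 0 < t < 1 -> beta_kernel (a + 1) (b + 1) x @[x --> t]
    --> beta_kernel (a + 1) (b + 1) t by exact: beta_kernel_continuous.
have dK t : t \in `]eps n, 1 - eps n[ -> 0 < t < 1.
  by move=> tK; apply: (@K01 n); apply: subset_itv_oo_cc tK.
have Zl r f : mu.-integrable (K n) (EFin \o f) ->
    r * \int[mu]_(t in K n) f t = \int[mu]_(t in K n) (r * f t).
  by move=> fi; rewrite RintegralZl//; exact: measurable_itv.
have Zi r f : mu.-integrable (K n) (EFin \o f) ->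
    mu.-integrable (K n) (EFin \o (fun t => r * f t)).
  move=> fi; have /= := integrableZl _ r fi; apply; exact: measurable_itv.
rewrite /J !Zl//.
rewrite -RintegralB//=; last 3 first.
- exact: measurable_itv.
- exact: Zi.
- exact: Zi.
rewrite /Rintegral (continuous_FTC2 (eps_half n) _
   (F := beta_kernel (a + 1) (b + 1)))//.
- apply: continuous_in_subspaceT => t; rewrite inE => /K01 t01.
  by apply: cvgB; (apply: cvgM; first exact: cvg_cst);
     exact: beta_kernel_continuous.
- split.
  + by move=> t /dK /(is_derive_beta_kernel a b)[].
  + apply: cvg_at_right_filter; apply: c; apply: (@K01 n).
    by rewrite /K/= in_itv/= lexx ltW.
  + apply: cvg_at_left_filter; apply: c; apply: (@K01 n).
    by rewrite /K/= in_itv/= lexx ltW.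
- move=> t /dK t01; rewrite derive1E.
  by have [_ ->] := is_derive_beta_kernel a b t01.
Qed.

(** Comes from [t + (1 - t) = 1]; it turns the recurrence in [a] into one in [b]. *)
Let J_split a b n : J a b n = J (a + 1) b n + J a (b + 1) n.
Proof.
rewrite /J -RintegralD//; last exact: measurable_itv.
apply: eq_Rintegral => t; rewrite inE => /K01 t01.
by rewrite beta_kernelDl// beta_kernelDr//; ring.
Qed.

(** At either end one factor is a positive power of [eps n], which tends to 0, and the other tends
    to 1. *)
Let beta_kernel_end_cvg0 a b : 0 < a -> 0 < b ->
  beta_kernel (a + 1) (b + 1) (1 - eps n) - beta_kernel (a + 1) (b + 1) (eps n)
    @[n --> \oo] --> (0 : R).
Proof.
move=> a0 b0.
have pow0 c : 0 < c -> eps n `^ c @[n --> \oo] --> (0 : R).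
  move=> c0; have /cvg_at_rightP := powR_cvg0 c0; apply; split; last exact: eps_cvg0.
  exact: eps_gt0.
have pow1 c : (1 - eps n) `^ c @[n --> \oo] --> (1 : R).
  rewrite [X in _ --> X](_ : _ = 1 `^ c); last by rewrite powR1.
  apply: (@continuous_cvg _ _ _ _ _ _ (fun x : R => x `^ c)).
    apply/differentiable_continuous; rewrite -derivable1_diffP.
    by have [] := is_derive1_powR c (@ltr01 R).
  rewrite -[X in _ --> X]subr0; apply: cvgB; [exact: cvg_cst|exact: eps_cvg0].
rewrite -FE /F -[X in _ --> X](subrr 0); apply: cvgB.
  rewrite -[X in _ --> X](mul1r 0); apply: cvgM; first exact: pow1.
  by under eq_fun do rewrite subKr; exact: pow0.
by rewrite -[X in _ --> X](mulr1 0); apply: cvgM; [exact: pow0|exact: pow1].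
Qed.

(** Monotone convergence, stated in the extended reals because integrability on []0, 1[] is deduced
    from it. *)
Let beta_kernel_cvg a b : 
  (\int[mu]_(t in K n) (beta_kernel a b t)%:E)%E @[n --> \oo] -->
  (\int[mu]_(t in `]0%R, 1%R[) (beta_kernel a b t)%:E)%E.
Proof.
rewrite -bigcup_K; apply: ge0_nondecreasing_set_cvg_integral => //.
- by move=> n; have /integrableP[] := integrable_K a b n.
- by move=> n t _; rewrite lee_fin beta_kernel_ge0.
Qed.

Let J_EFin a b n :
  ((J a b n)%:E = \int[mu]_(t in K n) (beta_kernel a b t)%:E)%E.
Proof.
rewrite /J /Rintegral fineK//; apply: integrable_fin_num (integrable_K a b n).
exact: measurable_itv.
Qed.

Let measurable_beta_kernel a b : measurable_fun `](0 : R), 1[ (beta_kernel a b).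
Proof.
apply: open_continuous_measurable_fun; first exact: interval_open.
by move=> t; rewrite inE /= in_itv /= => t01; exact: beta_kernel_continuous.
Qed.

(** For a nonnegative measurable kernel it suffices that the integral is finite, and uniqueness of
    limits identifies it with [l]. *)
Let integrable_of_cvg a b (l : R) : J a b n @[n --> \oo] --> l ->
  mu.-integrable `](0 : R), 1[ (EFin \o beta_kernel a b).
Proof.
move=> Jl; apply/integrableP; split.
  by apply/measurable_EFinP; exact: measurable_beta_kernel.
have -> : (\int[mu]_(t in `]0%R, 1%R[) `|(EFin \o beta_kernel a b) t| =
          \int[mu]_(t in `]0%R, 1%R[) (beta_kernel a b t)%:E)%E.
  apply: eq_integral => t _ /=; rewrite ger0_norm; first by [].
  exact: beta_kernel_ge0.
suff -> : (\int[mu]_(t in `]0%R, 1%R[) (beta_kernel a b t)%:E)%E = l%:E.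
  by rewrite ltry.
have Jl' : (J a b n)%:E @[n --> \oo] --> l%:E.
  by apply: cvg_EFin => //; exact: nearW.
have Jw : (fun n => (J a b n)%:E) =
    (fun n => \int[mu]_(t in K n) (beta_kernel a b t)%:E)%E.
  by apply/funext => n; exact: J_EFin.
by rewrite Jw in Jl'; exact: cvg_unique (@beta_kernel_cvg a b) Jl'.
Qed.

Let cvg_of_integrable a b : mu.-integrable `](0 : R), 1[ (EFin \o beta_kernel a b) ->
  J a b n @[n --> \oo] --> euler_beta a b.
Proof.
move=> ib; have := @beta_kernel_cvg a b.
rewrite -(@fineK _ (\int[mu]_(t in `]0%R, 1%R[) _)%E); last exact: integrable_fin_num.
by move=> /fine_cvg.
Qed.

Let integrable_beta_shiftl a b : 0 < a -> 0 < b ->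
  mu.-integrable `](0 : R), 1[ (EFin \o beta_kernel (a + 1) b) ->
  mu.-integrable `](0 : R), 1[ (EFin \o beta_kernel a b).
Proof.
move=> a0 b0 /cvg_of_integrable cJ.
apply: (@integrable_of_cvg _ _ (a^-1 * ((a + b) * euler_beta (a + 1) b + 0))).
have -> : J a b = (fun n => a^-1 * ((a + b) * J (a + 1) b n +
    (beta_kernel (a + 1) (b + 1) (1 - eps n) -
     beta_kernel (a + 1) (b + 1) (eps n)))).
  by apply/funext => n; rewrite -J_shift addrC subrK mulKf// gt_eqF.
apply: cvgM; first exact: cvg_cst.
apply: cvgD; last exact: beta_kernel_end_cvg0.
by apply: cvgM; first exact: cvg_cst.
Qed.

(** Eliminating [J (a + 1) b] from [J_shift] by [J_split] leaves [b * J a b = (a + b) * J a (b + 1)]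
    minus the end terms. *)
Let integrable_beta_shiftr a b : 0 < a -> 0 < b ->
  mu.-integrable `](0 : R), 1[ (EFin \o beta_kernel a (b + 1)) ->
  mu.-integrable `](0 : R), 1[ (EFin \o beta_kernel a b).
Proof.
move=> a0 b0 /cvg_of_integrable cJ.
apply: (@integrable_of_cvg _ _ (b^-1 * ((a + b) * euler_beta a (b + 1) - 0))).
have -> : J a b = (fun n => b^-1 * ((a + b) * J a (b + 1) n -
    (beta_kernel (a + 1) (b + 1) (1 - eps n) -
     beta_kernel (a + 1) (b + 1) (eps n)))).
  apply/funext => n; rewrite -J_shift; apply: (canRL (mulKf _)).
    by rewrite gt_eqF.
  by have := J_split a b n => ->; ring.
apply: cvgM; first exact: cvg_cst.
apply: cvgB; last exact: beta_kernel_end_cvg0.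
by apply: cvgM; first exact: cvg_cst.
Qed.

Lemma integrable_beta_kernel a b : 0 < a -> 0 < b ->
  mu.-integrable `](0 : R), 1[ (EFin \o beta_kernel a b).
Proof.
move=> a0 b0; apply: integrable_beta_shiftl => //.
apply: integrable_beta_shiftr => //; first by rewrite addr_gt0.
(* The exponents are now [a] and [b], both positive, so each power is at most 1. *)
apply: measurable_bounded_integrable; first exact: measurable_itv.
- by rewrite [X in (X < _)%E]lebesgue_measure_itv /= lte_fin ltr01 -EFinD ltry.
- exact: measurable_beta_kernel.
- exists 1; split => // M M1 t; rewrite /= in_itv /= => /andP[t0 t1].
  rewrite ger0_norm ?beta_kernel_ge0// (le_trans _ (ltW M1))//.
  have le1 x c : 0 < c -> 0 < x -> x < 1 -> x `^ (c + 1 - 1) <= 1.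
    move=> c0 x0 x1; rewrite addrK -(@powRr0 _ x) ger_powR// ?x0 ltW//.
  rewrite /beta_kernel mulr_ile1 ?powR_ge0 ?le1// ?subr_gt0//.
  by rewrite ltrBlDr ltrDl.
Qed.

(** This is the limit of [J_shift], whose end terms vanish. *)
Lemma euler_betaDl a b : 0 < a -> 0 < b ->
  (a + b) * euler_beta (a + 1) b = a * euler_beta a b.
Proof.
move=> a0 b0; apply/esym/eqP; rewrite -subr_eq0; apply/eqP.
have a1 : 0 < a + 1 by rewrite addr_gt0.
have D0 := beta_kernel_end_cvg0 a0 b0.
have DJ : (fun n => beta_kernel (a + 1) (b + 1) (1 - eps n) -
    beta_kernel (a + 1) (b + 1) (eps n)) =
    (fun n => a * J a b n - (a + b) * J (a + 1) b n).
  by apply/funext => n; rewrite J_shift.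
rewrite DJ in D0; apply: cvg_unique D0 => //.
by apply: cvgB; apply: cvgM; first [exact: cvg_cst |
  apply: cvg_of_integrable; exact: integrable_beta_kernel].
Qed.

Lemma euler_beta_gt0 a b : 0 < a -> 0 < b -> 0 < euler_beta a b.
Proof.
move=> a0 b0; have iab := integrable_beta_kernel a0 b0.
(* On [K 0] both [t] and [1 - t] lie in [[1/3, 1)]. Raising the exponent from [a - 1] to [a] lowers
   the power and makes it monotone in the base, so [1/3] gives a lower bound even when [a < 1];
   likewise for [b]. *)
pose c : R := 3%:R^-1 `^ a * 3%:R^-1 `^ b.
have c0 : 0 < c by rewrite mulr_gt0// powR_gt0// invr_gt0.
have cJ : c * (1 - eps 0 - eps 0) <= J a b 0.
  have -> : c * (1 - eps 0 - eps 0) = \int[mu]_(t in K 0) c.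
    rewrite Rintegral_cst; last exact: measurable_itv.
    by rewrite [X in fine X]lebesgue_measure_itv/= lte_fin eps_half.
  apply: le_Rintegral; first exact: measurable_itv.
  - apply: continuous_compact_integrable; first exact: segment_compact.
    by apply: continuous_subspaceT => x; exact: cst_continuous.
  - exact: integrable_K.
  - move=> t Kt; have /andP[t0 t1] := K01 Kt.
    have le x d : 0 < d -> 3%:R^-1 <= x -> x < 1 -> 3%:R^-1 `^ d <= x `^ (d - 1).
      move=> d0 x3 x1; have x0 : 0 < x by rewrite (lt_le_trans _ x3)// invr_gt0.
      apply: (@le_trans _ _ (x `^ d)).
        by rewrite ge0_ler_powR ?nnegrE// ltW// invr_gt0.
      by rewrite ger_powR ?x0 ?(ltW x1)// lerBlDr lerDl.
    move: Kt; rewrite /K /= in_itv /= => /andP[te et].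
    rewrite ler_pM ?powR_ge0// le//; first by rewrite lerBrDr addrC -lerBrDr.
    by rewrite ltrBlDr ltrDl.
apply: (lt_le_trans _ (le_trans cJ _)).
  by rewrite mulr_gt0// subr_gt0 eps_half.
rewrite /J /euler_beta /Rintegral fine_le//.
- apply: integrable_fin_num (integrable_K a b 0); exact: measurable_itv.
- apply: integrable_fin_num iab; exact: measurable_itv.
- apply: ge0_subset_integral.
  + exact: measurable_itv.
  + exact: measurable_itv.
  + by apply/measurable_EFinP; exact: measurable_beta_kernel.
  + by move=> t _; rewrite lee_fin beta_kernel_ge0.
  + by move=> t /K01; rewrite /= in_itv.
Qed.

End euler_beta_theory.

(** * Rising factorials and the Stirling expansion *)

Definition rising_factorial {T : pzSemiRingType} (y : T) (k : nat) : T :=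
  \prod_(i < k) (y + i%:R).

Lemma rising_factorialS (T : pzSemiRingType) (y : T) k :
  rising_factorial y k.+1 = rising_factorial y k * (y + k%:R).
Proof. by rewrite /rising_factorial big_ord_recr. Qed.

Lemma rising_factorial_gt0 (R : numDomainType) (y : R) k :
  0 < y -> 0 < rising_factorial y k.
Proof. by move=> y0; apply: prodr_gt0 => i _; rewrite ltr_wpDr. Qed.

Lemma rising_factorial_nat (R : numFieldType) n k : (1 <= n)%N ->
  rising_factorial (n%:R : R) k = (n - 1 + k)`!%:R / (n - 1)`!%:R.
Proof.
move=> n1; elim: k => [|k IH].
  by rewrite /rising_factorial big_ord0 addn0 divff// pnatr_eq0 -lt0n fact_gt0.
rewrite rising_factorialS IH addnS factS natrM -addSn subn1 prednK// natrD.
by rewrite mulrAC [X in X / _]mulrC.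
Qed.

Lemma rising_factorialN (T : comNzRingType) (y : T) k :
  \prod_(i < k) (- y - i%:R) = (-1) ^+ k * rising_factorial y k.
Proof.
elim: k => [|k IH]; first by rewrite /rising_factorial !big_ord0 mulr1.
by rewrite big_ord_recr /= IH rising_factorialS exprSr; ring.
Qed.

(** The defining Stirling expansion is mapped to [T] and evaluated at [- y], where falling
    factorials become signed rising ones. *)
Lemma pow_rising_factorial (T : comNzRingType) (y : T) j :
  y ^+ j = \sum_(k < j.+1)
    (-1) ^+ (j - k) * (stirling2 j k)%:~R * rising_factorial y k.
Proof.
have [/(congr1 (map_poly (intr : int -> T))) Sj _] := stirling2P j.
move/(congr1 (horner^~ (- y))) : Sj.
rewrite map_polyXn hornerXn rmorph_sum /= horner_sum => Sj.
have -> : y ^+ j = (-1) ^+ j * (- y) ^+ j by rewrite -exprMn mulrNN mul1r.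
rewrite Sj mulr_sumr.
apply: eq_bigr => k _; have kj : (k <= j)%N by rewrite -ltnS.
(* Since [k <= j] the subtraction is exact, so [j - k] and [j + k] have the same parity. *)
have -> : (-1) ^+ (j - k) = (-1) ^+ j * (-1) ^+ k :> T.
  by rewrite -[X in _ = (-1) ^+ X * _](subnK kj) exprD -mulrA -expr2 sqrr_sign mulr1.
rewrite map_polyZ hornerZ /falling_poly rmorph_prod horner_prod /=.
under eq_bigr => i _.
  rewrite rmorphB /= map_polyX map_polyC hornerD hornerN hornerX hornerC /= rmorph_nat.
  over.
by rewrite rising_factorialN; ring.
Qed.

Lemma poly_eq0_unit_interval (R : realFieldType) (p : {poly R}) :
  (forall x, x \in `[0, 1] -> p.[x] = 0) -> p = 0.
Proof.
move=> p0; apply/eqP/negPn/negP => pn0.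
(* These are [size p] distinct points of [[0, 1]], one more root than the degree allows. *)
pose s : seq R := [seq i.+1%:R^-1 | i <- iota 0 (size p)].
have us : uniq s.
  rewrite map_inj_uniq ?iota_uniq// => i j /invr_inj/eqP.
  by rewrite eqr_nat eqSS => /eqP.
have rs : all (root p) s.
  apply/allP => _ /mapP[i _ ->]; apply/rootP/p0.
  by rewrite in_itv /= invr_ge0 ler0n/= invf_le1// ler1n.
by have := max_poly_roots pn0 rs us; rewrite size_map size_iota ltnn.
Qed.

(* Evaluating at [x = - m / n], where all [rising_factorial (n x) k] with
   [m < k] vanish, makes the linear system for the coefficients triangular. *)
Lemma rising_factorial_free (R : realFieldType) n N (c : nat -> R) :
  (1 <= n)%N ->
  (forall x, x \in `[0, 1] ->
    \sum_(k < N) c k * rising_factorial (n%:R * x) k = 0) ->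
  forall k, (k < N)%N -> c k = 0.
Proof.
move=> n1 c0.
pose p : {poly R} :=
  \sum_(k < N) c k *: \prod_(i < k) (n%:R *: 'X + (i%:R)%:P).
have pE x : p.[x] = \sum_(k < N) c k * rising_factorial (n%:R * x) k.
  rewrite horner_sum; apply: eq_bigr => k _; rewrite hornerZ horner_prod.
  by congr (_ * _); apply: eq_bigr => i _; rewrite hornerD hornerZ hornerX hornerC.
have p0 : p = 0.
  by apply: poly_eq0_unit_interval => x /c0; rewrite pE.
elim/ltn_ind => m IH mN.
have := pE (- m%:R / n%:R); rewrite p0 horner0 mulrCA mulfV ?mulr1; last first.
  by rewrite pnatr_eq0 -lt0n.
rewrite (bigD1 (Ordinal mN))//= big1 ?addr0 => [|k km].
  move/esym/eqP; rewrite mulf_eq0 => /orP[/eqP//|/prodf_eq0[i _]].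
  by rewrite addrC subr_eq0 eqr_nat ltn_eqF.
have [ltkm|lemk] := ltnP k m; first by rewrite IH ?mul0r// (ltn_trans ltkm).
have mk : (m < k)%N.
  by rewrite ltn_neqAle lemk andbT; apply: contraNneq km => e; apply/eqP/val_inj.
by rewrite /rising_factorial (bigD1 (Ordinal mk))//= addNr mul0r mulr0.
Qed.

(** * The Beta operator on polynomials and its inverse *)

Section genuine_beta_polynomials.
Context {R : realType}.
Local Notation mu := (@lebesgue_measure R).
Implicit Types (a b : R) (n : nat) (p : {poly R}).

(** Iterates [euler_betaDl]: step [k] contributes the factor [(a + k) / (a + b + k)]. *)
Lemma euler_beta_rising a b k : 0 < a -> 0 < b ->
  euler_beta (a + k%:R) b =
  rising_factorial a k / rising_factorial (a + b) k * euler_beta a b.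
Proof.
move=> a0 b0; elim: k => [|k IH].
  by rewrite /rising_factorial !big_ord0 addr0 divr1 mul1r.
have ak : 0 < a + k%:R by rewrite ltr_wpDr.
rewrite -natr1 addrA; apply: (@mulfI _ (a + k%:R + b)).
  by rewrite gt_eqF// addr_gt0.
rewrite euler_betaDl// IH !rising_factorialS.
have r0 : rising_factorial (a + b) k != 0.
  by rewrite gt_eqF// rising_factorial_gt0// addr_gt0.
have s0 : a + b + k%:R != 0 by rewrite gt_eqF// ltr_wpDr// addr_gt0.
by field; rewrite r0 s0.
Qed.

(** Each power [t ^+ k] is absorbed into the kernel by raising its first parameter by [k]. *)
Lemma Rintegral_beta_kernel_horner a b N p :
  0 < a -> 0 < b -> (size p <= N)%N ->
  \int[mu]_(t in `]0, 1[) (beta_kernel a b t * p.[t]) =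
  \sum_(k < N) p`_k * euler_beta (a + k%:R) b.
Proof.
move=> a0 b0 pN.
have ib k : mu.-integrable `](0 : R), 1[ (EFin \o beta_kernel (a + k%:R) b).
  by apply: integrable_beta_kernel => //; rewrite ltr_wpDr.
have iZ r (f : R -> R) : mu.-integrable `](0 : R), 1[ (EFin \o f) ->
    mu.-integrable `](0 : R), 1[ (EFin \o (fun t => r * f t)).
  by move=> fi; have /= := integrableZl _ r fi; apply; exact: measurable_itv.
transitivity (\int[mu]_(t in `]0, 1[)
    \sum_(k < N) p`_k * beta_kernel (a + k%:R) b t).
  apply: eq_Rintegral => t; rewrite inE /= in_itv /= => /andP[t0 _].
  rewrite (horner_coef_wide _ pN) mulr_sumr; apply: eq_bigr => k _.
  by rewrite beta_kernelXl// mulrCA.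
(* Integrability joins the induction because additivity of the integral requires it of the partial
   sum. *)
suff [] : mu.-integrable `](0 : R), 1[
    (EFin \o (fun t => \sum_(k < N) p`_k * beta_kernel (a + k%:R) b t)) /\
  \int[mu]_(t in `]0, 1[) (\sum_(k < N) p`_k * beta_kernel (a + k%:R) b t) =
  \sum_(k < N) p`_k * euler_beta (a + k%:R) b by [].
elim: N {pN} => [|N [IHi IHe]].
  rewrite big_ord0; split.
    rewrite (_ : _ \o _ = cst 0%E); first exact: integrable0.
    by apply/funext => t /=; rewrite big_ord0.
  rewrite (_ : (fun _ => _) = cst 0).
    by rewrite Rintegral_cst ?mul0r//; exact: measurable_itv.
  by apply/funext => t /=; rewrite big_ord0.
have E : (fun t => \sum_(k < N.+1) p`_k * beta_kernel (a + k%:R) b t) =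
  (fun t => \sum_(k < N) p`_k * beta_kernel (a + k%:R) b t +
            p`_N * beta_kernel (a + N%:R) b t).
  by apply/funext => t; rewrite big_ord_recr.
rewrite E big_ord_recr /= -IHe; split.
  have /= := integrableD _ IHi (iZ p`_N _ (ib N)); apply; exact: measurable_itv.
rewrite RintegralD; last exact: (iZ _ _ (ib N)); last 2 first.
- exact: measurable_itv.
- exact: IHi.
by rewrite (RintegralZl _ _ (ib N)); last exact: measurable_itv.
Qed.

(** [N] may exceed [size p], so that two polynomials can be compared over one common range. *)
Lemma genuine_beta_horner n N p x : (1 <= n)%N -> (size p <= N)%N ->
  x \in `[0, 1] -> genuine_beta n (horner p) x =
  \sum_(k < N) p`_k / rising_factorial n%:R k * rising_factorial (n%:R * x) k.
Proof.
move=> n1 pN; rewrite in_itv /= => /andP[x0 x1].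
have n0 : 0 < n%:R :> R by rewrite ltr0n.
(* At 0 every rising factorial of positive order contains the factor 0, so only the constant
   coefficient survives. *)
rewrite /genuine_beta; have [->|xn0] := eqVneq x 0.
  rewrite horner_coef0; case: N pN => [|N] pN.
    by rewrite big_ord0 nth_default.
  rewrite big_ord_recl /= /rising_factorial !big_ord0 divr1 mulr1 big1 ?addr0//.
  by move=> k _; rewrite [X in _ * X]big_ord_recl /= mulr0 addr0 mul0r mulr0.
have [->|xn1] := eqVneq x 1.
  rewrite (horner_coef_wide _ pN); apply: eq_bigr => k _.
  by rewrite mulr1 expr1n mulr1 divfK// gt_eqF// rising_factorial_gt0.
have x0' : 0 < x by rewrite lt_neqAle eq_sym xn0.
have x1' : 0 < 1 - x by rewrite subr_gt0 lt_neqAle xn1.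
have a0 : 0 < n%:R * x by rewrite mulr_gt0.
have b0 : 0 < n%:R * (1 - x) by rewrite mulr_gt0.
have := Rintegral_beta_kernel_horner a0 b0 pN; rewrite /beta_kernel => ->.
rewrite mulr_sumr; apply: eq_bigr => k _; rewrite euler_beta_rising//.
(* The two Beta parameters add up to [n], so the denominators do not depend on [x]. *)
rewrite -mulrDr subrKC mulr1.
have B0 : euler_beta (n%:R * x) (n%:R * (1 - x)) != 0.
  by rewrite gt_eqF// euler_beta_gt0.
have r0 : rising_factorial (n%:R : R) k != 0.
  by rewrite gt_eqF// rising_factorial_gt0.
by field; rewrite r0 B0.
Qed.

Lemma genuine_beta_horner_inj n p q : (1 <= n)%N ->
  (forall x, x \in `[0, 1] ->
    genuine_beta n (horner p) x = genuine_beta n (horner q) x) -> p = q.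
Proof.
move=> n1 pq; pose N := maxn (size p) (size q).
apply/polyP => k; have [kN|Nk] := ltnP k N; last first.
  by rewrite !nth_default// (leq_trans _ Nk)// ?leq_maxl ?leq_maxr.
(* The difference of the two images is a vanishing combination of rising factorials, so its
   coefficients are 0. *)
have := @rising_factorial_free R n N
  (fun k => (p`_k - q`_k) / rising_factorial n%:R k) n1 _ k kN.
move=> /(_ _)/eqP; rewrite mulf_eq0 invr_eq0 (gt_eqF (rising_factorial_gt0 _ _)).
  rewrite orbF subr_eq0 => /(_ _)/eqP; apply=> x x01.
  under eq_bigr do rewrite !mulrBl.
  rewrite sumrB; apply/eqP; rewrite subr_eq0; apply/eqP.
  by rewrite -!genuine_beta_horner// ?pq// ?leq_maxl ?leq_maxr.
by rewrite ltr0n.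
Qed.

(** The factorial quotient is kept as a rising factorial of [n], to cancel the denominators in
    [genuine_beta_horner]. *)
Definition genuine_beta_inv_coef n j k : R :=
  (n%:R ^+ j)^-1 * ((-1) ^+ (j - k) * rising_factorial n%:R k
    * (stirling2 j k)%:~R).

(** Injectivity leaves [xget] at most one candidate, so it suffices to check the image of this
    polynomial: after cancellation it is the Stirling expansion of [(n x)^j], divided by [n^j]. *)
Lemma genuine_beta_inv_Xn n j : (1 <= n)%N ->
  genuine_beta_inv n 'X^j = \poly_(k < j.+1) genuine_beta_inv_coef n j k.
Proof.
move=> n1; rewrite /genuine_beta_inv; apply: xget_subset1; last first.
  by move=> p q /= pX qX; apply: (genuine_beta_horner_inj n1) => x x01;
     rewrite pX// qX.
move=> x x01 /=; rewrite (genuine_beta_horner n1 (size_poly _ _) x01) hornerXn.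
have n0 : n%:R != 0 :> R by rewrite pnatr_eq0 -lt0n.
have -> : x ^+ j = (n%:R ^+ j)^-1 * (n%:R * x) ^+ j.
  by rewrite exprMn mulKf ?expf_neq0.
rewrite [X in _ = _ * X]pow_rising_factorial mulr_sumr; apply: eq_bigr => k _.
have r0 : rising_factorial (n%:R : R) k != 0.
  by rewrite gt_eqF// rising_factorial_gt0// ltr0n.
rewrite coef_poly ltn_ord /genuine_beta_inv_coef.
by field; rewrite r0 expf_neq0.
Qed.

Lemma sum_genuine_beta_inv_coef n j : (1 <= n)%N ->
  \sum_(k < j.+1) genuine_beta_inv_coef n j k = 1.
Proof.
move=> n1; have n0 : n%:R != 0 :> R by rewrite pnatr_eq0 -lt0n.
rewrite -mulr_sumr -[RHS](mulVf (expf_neq0 j n0)); congr (_ * _).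
rewrite [RHS]pow_rising_factorial; apply: eq_bigr => k _; exact: mulrAC.
Qed.

(** * Rate of convergence of the inverse images *)

Lemma rising_factorial_nat_le n k : (1 <= n)%N ->
  rising_factorial (n%:R : R) k <= k.+1%:R ^+ k * n%:R ^+ k.
Proof.
move=> n1; rewrite -exprMn -[X in _ ^+ X]card_ord -prodr_const.
(* Factorwise, [i < k] and [1 <= n] give [n + i <= (k + 1) n]. *)
apply: ler_prod => i _; rewrite addr_ge0//= -natrD -natrM ler_nat.
by rewrite mulSn leq_add2l (leq_trans (ltnW (ltn_ord i)))// leq_pmulr.
Qed.

(** The rising factorial is of order [n^k] with [k <= j - 1], so dividing by [n^j] leaves at least
    one factor [1 / n]. *)
Lemma genuine_beta_inv_coef_le j k : (k < j)%N -> exists C : R,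
  forall n, (1 <= n)%N -> `|genuine_beta_inv_coef n j k| <= C / n%:R.
Proof.
move=> kj; exists (k.+1%:R ^+ k * `|(stirling2 j k)%:~R|) => n n1.
have n0 : 0 < n%:R :> R by rewrite ltr0n.
rewrite /genuine_beta_inv_coef !normrM normfV normrX normr_sign mul1r normr_nat.
rewrite (ger0_norm (ltW (rising_factorial_gt0 _ n0))).
rewrite mulrA [X in _ <= X]mulrAC ler_wpM2r//.
rewrite mulrC ler_pdivrMr ?exprn_gt0//.
apply: (le_trans (rising_factorial_nat_le k n1)).
rewrite -mulrA ler_wpM2l ?exprn_ge0// -[j](@prednK j) ?(leq_ltn_trans _ kj)//.
rewrite exprS mulrA mulVf ?gt_eqF// mul1r ler_weXn2l ?ler1n//.
by rewrite -ltnS prednK// (leq_ltn_trans _ kj).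
Qed.

Lemma genuine_beta_inv_Xn_bound j : exists C : R, forall n x, (1 <= n)%N ->
  x \in `[0, 1] -> `|(genuine_beta_inv n 'X^j).[x] - x ^+ j| <= C / n%:R.
Proof.
have /choice[C HC] : forall k : 'I_j, exists C : R,
    forall n, (1 <= n)%N -> `|genuine_beta_inv_coef n j k| <= C / n%:R.
  by move=> k; exact: genuine_beta_inv_coef_le.
exists (\sum_(k < j) C k) => n x n1; rewrite in_itv /= => /andP[x0 x1].
rewrite genuine_beta_inv_Xn// horner_poly.
(* As the coefficients sum to 1, the error becomes a combination of the differences [x^k - x^j]. The
   term [k = j] drops out, and the other differences are at most 1 in absolute value. *)
have -> : x ^+ j = \sum_(k < j.+1) genuine_beta_inv_coef n j k * x ^+ j.
  by rewrite -mulr_suml sum_genuine_beta_inv_coef// mul1r.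
rewrite -sumrB.
rewrite big_ord_recr /= subrr addr0 mulr_suml.
apply: (le_trans (ler_norm_sum _ _ _)); apply: ler_sum => k _.
rewrite -mulrBr normrM -[leRHS]mulr1; apply: ler_pM => //; first exact: HC.
have xl i : x ^+ i <= 1 by exact: exprn_ile1.
have xg i : 0 <= x ^+ i by exact: exprn_ge0.
rewrite ler_norml; apply/andP; split.
  by have := xl j; have := xg k; lra.
by have := xg j; have := xl k; lra.
Qed.

End genuine_beta_polynomials.

Theorem mainTheorem6 (R : realType) :
  (forall n j : nat, (1 <= n)%N ->
     genuine_beta_inv n ('X^j : {poly R}) =
       (n%:R ^+ j)^-1 *:
         \sum_(k < j.+1)
           ((-1) ^+ (j - k) * (((n - 1 + k)`!)%:R / ((n - 1)`!)%:R)
             * (stirling2 j k)%:~R) *: 'X^k)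
  /\
  (forall j : nat,
     {uniform `[0, 1]%classic,
       (fun (n : nat) (x : R) => (genuine_beta_inv n ('X^j : {poly R})).[x]) @ \oo
         --> (fun x : R => ('X^j : {poly R}).[x])}).
Proof.
split=> [n j n1|j].
  rewrite genuine_beta_inv_Xn// poly_def scaler_sumr; apply: eq_bigr => k _.
  by rewrite scalerA /genuine_beta_inv_coef rising_factorial_nat.
have [C HC] := genuine_beta_inv_Xn_bound (R := R) j.
move=> P /uniform_nbhs[E [/= entE subP]].
have [e e0 eE] : exists2 e : R, 0 < e & [set xy | `|xy.1 - xy.2| < e] `<=` E.
  move: entE; rewrite -entourage_ballE => -[e /= e0 eE].
  by exists e => // -[u v] /= uv; apply: eE.
have C0 : C * harmonic n @[n --> \oo] --> (0 : R).
  rewrite -[X in _ --> X](mulr0 C); apply: cvgM; first exact: cvg_cst.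
  exact: cvg_harmonic.
have [m _ Hm] := (cvgr0Pnorm_lt _).1 C0 _ e0.
(* [harmonic n] is [1 / (n + 1)], so it controls the operator of index [n.+1]; starting at [m.+1]
   excludes index 0. *)
exists m.+1 => // -[//|n] /= mn; apply: subP => x /= x01; apply: eE => /=.
rewrite hornerXn distrC; apply: le_lt_trans (HC n.+1 x isT x01) _.
exact: le_lt_trans (ler_norm _) (Hm n mn).
Qed.
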